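(* Let $G$ be a graph with $\mathrm{mad}(G)<3$ such that no induced subgraph of $G$ is almost-cubic. Then $\chi_c^{\bullet}(G)\leq 3$.
   Context: All graphs are finite and simple. $\mathrm{mad}(G)$ is the maximum average degree over all subgraphs of $G$. A graph is almost-cubic if it is $2$-connected, exactly one of its vertices has degree $2$, and all other vertices have degree $3$. A correspondence-cover of a graph $G$ is a pair $(L,H)$ where $H$ is a graph and $L$ maps each $v\in V(G)$ to a subset $L(v)\subseteq V(H)$ such that: the sets $L(v)$ partition $V(H)$; each $L(v)$ induces a clique in $H$; if $uv\notin E(G)$ there are no edges of $H$ between $L(u)$ and $L(v)$; if $uv\in E(G)$ the edges of $H$ between $L(u)$ and $L(v)$ form a matching. The cover is $k$-fold if $|L(v)|=k$ for all $v$. An independent transversal of $(L,H)$ is an independent set of $H$ containing exactly one vertex of each $L(v)$. A cover $(L,H)$ has a fractional packing if there is a probability distribution on independent transversals $I$ such that $\Pr(x\in I)=1/|L(v)|$ for every $v$ and every $x\in L(v)$. $\chi_c^{\bullet}(G)$ is the least $k\geq1$ such that every $k$-fold correspondence-cover of $G$ has a fractional packing. *)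

(* Defs.v *)
From HB Require Import structures.
From mathcomp Require Import all_boot all_order all_algebra.
From mathcomp Require Import Rstruct.
From Stdlib Require Rdefinitions.
Set Implicit Arguments. Unset Strict Implicit. Unset Printing Implicit Defensive.
Import Order.TTheory GRing.Theory Num.Theory.
Local Open Scope ring_scope.

Definition simple_graph (T : finType) (e : rel T) : Prop :=
  symmetric e /\ irreflexive e.

(* Subgraphs of G: a vertex set S and a symmetric arc set F (each undirected
   edge uv is stored as the two arcs (u,v),(v,u)) of edges of G inside S. *)
Definition is_subgraph (T : finType) (e : rel T) (S : {set T}) (F : {set T * T}) : bool :=
  [forall p in F, [&& p.1 \in S, p.2 \in S & e p.1 p.2]] &&
  [forall p in F, (p.2, p.1) \in F].

(* average degree of a nonempty subgraph (S,F): (sum of degrees)/|S| = #arcs/|S| *)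
Definition avg_degree (T : finType) (S : {set T}) (F : {set T * T}) : rat :=
  (#|F|%:R / #|S|%:R)%R.

Definition mad (T : finType) (e : rel T) : rat :=
  \big[Num.max/0]_(SF : {set T} * {set T * T} | (SF.1 != set0) && is_subgraph e SF.1 SF.2)
     avg_degree SF.1 SF.2.

Definition deg_in (T : finType) (e : rel T) (S : {set T}) (v : T) : nat :=
  #|[set u in S | e v u]|.

Definition induced_rel (T : finType) (e : rel T) (S : {set T}) : rel T :=
  [rel x y | [&& x \in S, y \in S & e x y]].

Definition connected_in (T : finType) (e : rel T) (S : {set T}) : Prop :=
  S != set0 /\ forall x y, x \in S -> y \in S -> connect (induced_rel e S) x y.

Definition two_connected_in (T : finType) (e : rel T) (S : {set T}) : Prop :=
  (3 <= #|S|)%N /\ connected_in e S /\ forall v, v \in S -> connected_in e (S :\ v).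

Definition almost_cubic_in (T : finType) (e : rel T) (S : {set T}) : Prop :=
  two_connected_in e S /\
  (exists v, [/\ v \in S, deg_in e S v = 2%N &
                forall u, u \in S -> u != v -> deg_in e S u = 3%N]).

Definition corr_cover (T : finType) (e : rel T) (W : finType) (h : rel W)
    (L : T -> {set W}) : Prop :=
  simple_graph h /\
  (forall w : W, #|[set v | w \in L v]| = 1%N) /\
  (forall v x y, x \in L v -> y \in L v -> x != y -> h x y) /\
  (forall u v x y, u != v -> ~~ e u v -> x \in L u -> y \in L v -> ~~ h x y) /\
  (forall u v x, e u v -> x \in L u -> (#|[set y in L v | h x y]| <= 1)%N).

Definition kfold (T : finType) (W : finType) (L : T -> {set W}) (k : nat) : Prop :=
  forall v, #|L v| = k.

Definition indep_transversal (T : finType) (W : finType) (h : rel W)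
    (L : T -> {set W}) (I : {set W}) : bool :=
  [forall v, #|I :&: L v| == 1%N] && [forall x in I, forall y in I, ~~ h x y].

Definition fractional_packing (T : finType) (W : finType) (h : rel W)
    (L : T -> {set W}) : Prop :=
  exists p : {set W} -> Rdefinitions.R,
    (forall I, 0 <= p I) /\
    (forall I, p I != 0 -> indep_transversal h L I) /\
    (\sum_(I : {set W}) p I = 1) /\
    (forall v x, x \in L v -> \sum_(I : {set W} | x \in I) p I = (#|L v|%:R)^-1).

Definition all_kfold_covers_pack (T : finType) (e : rel T) (k : nat) : Prop :=
  forall (W : finType) (h : rel W) (L : T -> {set W}),
    corr_cover e h L -> kfold L k -> fractional_packing h L.

(* chi_c^bullet(G) <= k, i.e. the least k' >= 1 with the packing property exists
   and is at most k. *)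
Definition chi_c_bullet_le (T : finType) (e : rel T) (k : nat) : Prop :=
  exists k', [/\ (1 <= k')%N, (k' <= k)%N & all_kfold_covers_pack e k'].

(* Main.v *)
Require Import Defs.
From mathcomp Require Import all_boot all_order all_algebra.
From mathcomp Require Import fingroup perm zify ring.
From mathcomp Require Import Rstruct.
From Stdlib Require Rdefinitions.
Set Implicit Arguments. Unset Strict Implicit. Unset Printing Implicit Defensive.

(* Every 3-fold cover of G[S] is fractionally packed by induction on |S|.
   Packings of two induced subgraphs meeting in a single vertex glue, by coupling
   them conditionally on the colour of that vertex, so G[S] may be assumed
   2-connected.  Let H be an induced forest in G[S] all of whose vertices have at
   most one neighbour in S \ H.  A packing of G[S \ H] extends: the outside
   neighbour of v in H forbids one uniformly random colour at v, leaving a list of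
   size 2, and a forest with lists of size 2 has a pair of colourings which
   together use both colours of every list; choosing one of the two by a fair coin
   makes the colour at v uniform on its list, hence uniform.

   Such an H exists in a 2-connected G[S] which is not almost-cubic and has average
   degree < 3.  If two vertices of degree 2 are joined through vertices of degree
   at most 3, an induced path joining them works.  Otherwise every component of
   the vertices of degree at most 3 has at most one vertex of degree 2.  By
   2-connectedness a component with such a vertex touches two vertices of degree
   at least 4, so counting gives a vertex z of degree d >= 4 touching at least
   d - 1 of these components; z together with induced paths from z to their
   vertices of degree 2 works. *)

(** * Degrees into a vertex set *)

Lemma deg_inU1 (T : finType) (e : rel T) (H : {set T}) x v :
  x \notin H -> deg_in e (x |: H) v = e v x + deg_in e H v.
Proof.
move=> xH; rewrite /deg_in; case: (boolP (e v x)) => evx.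
  have -> : [set u in x |: H | e v u] = x |: [set u in H | e v u].
    by apply/setP=> u; rewrite !inE; case: eqP => [->|].
  by rewrite cardsU1 !inE (negbTE xH).
apply: eq_card => u; rewrite !inE; case: eqP => [->|] //.
by rewrite (negbTE evx) !andbF.
Qed.

Lemma deg_in_mono (T : finType) (e : rel T) (A B : {set T}) v :
  A \subset B -> deg_in e A v <= deg_in e B v.
Proof.
move=> sAB; apply: subset_leq_card; apply/subsetP=> u; rewrite !inE.
by case/andP=> /(subsetP sAB) ->.
Qed.

Lemma deg_inD (T : finType) (e : rel T) (A B : {set T}) v :
  A \subset B -> deg_in e B v = deg_in e A v + deg_in e (B :\: A) v.
Proof.
move=> sAB; rewrite /deg_in -(cardsID A); congr (_ + _).
  apply: eq_card => u; rewrite !inE.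
  by case: (boolP (u \in A)) => [/(subsetP sAB) ->|]; rewrite ?andbT ?andbF.
by apply: eq_card => u; rewrite !inE andbA.
Qed.

Lemma deg_inU (T : finType) (e : rel T) (A B : {set T}) v :
  deg_in e (A :|: B) v <= deg_in e A v + deg_in e B v.
Proof.
rewrite /deg_in (_ : [set u in A :|: B | e v u] =
  [set u in A | e v u] :|: [set u in B | e v u]).
  exact: leq_card_setU.
by apply/setP=> u; rewrite !inE andb_orl.
Qed.

Lemma deg_in_eq0 (T : finType) (e : rel T) (A : {set T}) v :
  (forall u, u \in A -> ~~ e v u) -> deg_in e A v = 0.
Proof.
move=> nA; apply/eqP; rewrite cards_eq0; apply/eqP/setP=> u; rewrite !inE.
by case: (boolP (u \in A)) => // /nA /negbTE.
Qed.

Lemma deg_in_le1 (T : finType) (e : rel T) (A : {set T}) v y :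
  (forall u, u \in A -> e v u -> u = y) -> deg_in e A v <= 1.
Proof.
move=> uA; rewrite -(cards1 y); apply: subset_leq_card.
by apply/subsetP=> u; rewrite !inE => /andP [uin /(uA _ uin) ->].
Qed.

Lemma deg_in_gt0 (T : finType) (e : rel T) (A : {set T}) v y :
  y \in A -> e v y -> 0 < deg_in e A v.
Proof. by move=> yA evy; apply/card_gt0P; exists y; rewrite inE yA. Qed.

(** * Induced forests and paths *)

(** Forests given by a leaf-adding order: a colouring built along it meets at most one coloured
    neighbour at each step. *)
Inductive forest (T : finType) (e : rel T) : {set T} -> Prop :=
| forest0 : forest e set0
| forestU1 H v : forest e H -> v \notin H -> deg_in e H v <= 1 ->
    forest e (v |: H).

(* [ipath e Q x P]: P is the vertex set of an induced path from x whose last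
   vertex is its only vertex in Q. *)
Inductive ipath (T : finType) (e : rel T) (Q : {set T}) : T -> {set T} -> Prop :=
| ipath1 x : x \in Q -> ipath e Q x [set x]
| ipathU1 x y P : ipath e Q y P -> x \notin Q -> x \notin P -> e x y ->
    (forall u, u \in P -> e x u -> u = y) -> ipath e Q x (x |: P).

Lemma ipath_suffix (T : finType) (e : rel T) (Q P : {set T}) x y :
  ipath e Q y P -> x \in P -> exists2 P' : {set T}, P' \subset P & ipath e Q x P'.
Proof.
move=> ip; elim: ip x => {y P} [y yQ|y z P ip IH yQ yP eyz uy] x.
  by move/set1P->; exists [set y] => //; apply: ipath1.
case/setU1P => [->|xP]; first by exists (y |: P) => //; apply: ipathU1 ip _ _ _ _.
by have [P' sP' ip'] := IH x xP; exists P' => //; apply: subset_trans sP' (subsetUr _ _).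
Qed.

(** Attaching [x] at its last neighbour on [P] instead of at [u] keeps the extended path induced. *)
Lemma ipath_attach (T : finType) (e : rel T) (Q P : {set T}) x y u :
  ipath e Q y P -> u \in P -> e x u ->
  exists v (P' : {set T}), [/\ P' \subset P, ipath e Q v P', e x v &
                   forall w, w \in P' -> e x w -> w = v].
Proof.
move=> ip; elim: ip u => {y P} [y yQ|y z P ip IH yQ yP eyz uy] u.
  move/set1P-> => exy; exists y, [set y]; split=> //; first exact: ipath1.
  by move=> w /set1P.
move=> uP exu.
case: (boolP [exists w in P, e x w]) => [/exists_inP [w wP exw]|].
  have [v [P' [sP' ip' exv uP']]] := IH w wP exw.
  by exists v, P'; split=> //; apply: subset_trans sP' (subsetUr _ _).
move/exists_inPn => nP; exists y, (y |: P); split=> //; first exact: ipathU1 ip _ _ _ _.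
  by case/setU1P: uP exu => [->|/nP /negbTE ->].
by move=> w /setU1P [->|/nP /negbTE ->].
Qed.

Lemma ipath_exists (T : finType) (e : rel T) (Q : {set T}) x p :
  path e x p -> last x p \in Q ->
  exists2 P : {set T}, ipath e Q x P & {subset P <= x :: p}.
Proof.
elim: p x => [|y p IH] x /=.
  move=> _ xQ; exists [set x]; first exact: ipath1.
  by move=> u /set1P ->; rewrite inE.
case/andP=> exy yp lQ; have [P ip sP] := IH y yp lQ.
have sub (P' : {set T}) : P' \subset P -> {subset P' <= x :: y :: p}.
  by move=> sP' u /(subsetP sP') /sP uyp; rewrite inE uyp orbT.
case: (boolP (x \in Q)) => xQ.
  exists [set x]; first exact: ipath1.
  by move=> u /set1P ->; rewrite inE eqxx.
case: (boolP (x \in P)) => xP.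
  by have [P' sP' ip'] := ipath_suffix ip xP; exists P' => //; apply: sub.
have yP : y \in P by case: ip => *; rewrite !inE eqxx.
have [v [P' [sP' ip' exv uP']]] := ipath_attach ip yP exy.
exists (x |: P'); last by move=> u /setU1P [->|/(sub _ sP')] //; rewrite inE eqxx.
by apply: ipathU1 ip' _ _ exv uP' => //; apply: contra xP; apply: (subsetP sP').
Qed.

Lemma ipath_head (T : finType) (e : rel T) (Q P : {set T}) x :
  ipath e Q x P -> x \in P.
Proof. by case=> *; rewrite !inE eqxx. Qed.

Lemma ipath_last (T : finType) (e : rel T) (Q P : {set T}) x :
  ipath e Q x P -> exists2 q, q \in P & q \in Q.
Proof.
elim=> {x P} [x xQ|x y P _ [q qP qQ] _ _ _ _]; first by exists x; rewrite ?inE.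
by exists q => //; rewrite inE qP orbT.
Qed.

(** The first vertex lacks a predecessor and the last one a successor; membership in [Q] makes up
    for the missing successor. *)
Lemma ipath_deg (T : finType) (e : rel T) (Q P : {set T}) x v :
  symmetric e -> ipath e Q x P -> v \in P ->
  (v != x).+1 <= deg_in e P v + (v \in Q).
Proof.
move=> symE ip; elim: ip v => {x P} [x xQ|x y P ip IH xQ xP exy uy] v.
  by move/set1P=> ->; rewrite xQ eqxx addn1.
rewrite deg_inU1 //; case/setU1P => [->|vP].
  have := deg_in_gt0 (ipath_head ip) exy; rewrite eqxx; lia.
have := IH v vP; case: (eqVneq v y) => [->|nvy] /=.
  by rewrite [e y x]symE exy; lia.
by case: (v != x) => /=; lia.
Qed.

(** [P] is added from its last vertex backwards: that vertex has at most one neighbour in [B], and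
    each earlier one sees only its successor. *)
Lemma ipath_forest (T : finType) (e : rel T) (Q P B : {set T}) x :
  forest e B -> ipath e Q x P -> [disjoint P & B] ->
  (forall v, v \in P -> deg_in e B v <= (v \in Q)) -> forest e (P :|: B).
Proof.
move=> fB ip; elim: ip => {x P} [x xQ|x y P ip IH xQ xP exy uy] dPB dB.
  apply: forestU1 => //; last by apply: leq_trans (dB x _) _; rewrite ?inE ?leq_b1.
  by move: dPB; rewrite disjoints1.
rewrite -setUA; apply: forestU1.
- apply: IH => [|v vP]; last by apply: dB; rewrite inE vP orbT.
  by apply: disjointWl dPB; apply: subsetUr.
- rewrite inE (negbTE xP) /=; move: dPB.
  by move/disjointFr => -> //; rewrite !inE eqxx.
- apply: leq_trans (deg_inU _ _ _ _) _.
  have := dB x; rewrite !inE eqxx (negbTE xQ) => /(_ isT).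
  have := deg_in_le1 uy; lia.
Qed.

Lemma connect_induced_sub (T : finType) (e : rel T) (A B : {set T}) x y :
  A \subset B -> connect (induced_rel e A) x y -> connect (induced_rel e B) x y.
Proof.
move=> /subsetP sAB; apply: connect_sub => a b /and3P [aA bA eab].
by apply: connect1; rewrite /induced_rel /= !sAB.
Qed.

Lemma connect_induced_mem (T : finType) (e : rel T) (A : {set T}) x y :
  x \in A -> connect (induced_rel e A) x y -> y \in A.
Proof.
move=> xA /connectP [p]; elim/last_ind: p => [_ -> //|p z _].
by rewrite rcons_path last_rcons => /andP [_ /and3P []] _ zA _ ->.
Qed.

Lemma connected_in_closed (T : finType) (e : rel T) (A K : {set T}) x :
  connected_in e A -> x \in A -> x \in K ->
  (forall a b, a \in K -> b \in A -> e a b -> b \in K) -> A \subset K.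
Proof.
move=> [_ cA] xA xK clK; apply/subsetP=> y yA.
case/connectP: (cA x y xA yA) => p; elim/last_ind: p y yA => [y _ _ -> //|p z IH y yA].
rewrite rcons_path last_rcons => /andP [pp /and3P [lA zA elz]] ->.
by apply: clK elz => //; apply: IH.
Qed.

Lemma connected_in_setD1 (T : finType) (e : rel T) (S : {set T}) :
  2 < #|S| -> (forall v, v \in S -> connected_in e (S :\ v)) -> connected_in e S.
Proof.
move=> S3 cS; split; first by rewrite -card_gt0; lia.
move=> x y xS yS.
(* Deleting a third vertex leaves [x] and [y] in a connected graph. *)
have : 0 < #|S :\ x :\ y|.
  by move: (cardsD1 x S) (cardsD1 y (S :\ x)); rewrite xS; case: (y \in _) => /=; lia.
case/card_gt0P => z; rewrite !inE => /and3P [zy zx zS].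
apply: (@connect_induced_sub _ _ (S :\ z)); first exact: subsetDl.
by have [_] := cS z zS; apply; rewrite !inE 1?eq_sym ?zx ?zy.
Qed.

Lemma induced_path (T : finType) (e : rel T) (A Q : {set T}) x y :
  connect (induced_rel e A) x y -> y \in Q ->
  exists2 P : {set T}, ipath e Q x P &
    forall v, v \in P -> connect (induced_rel e A) x v.
Proof.
case/connectP=> p pp -> lQ.
have pe : path e x p by apply: sub_path pp => a b /and3P [].
have [P ip sP] := ipath_exists pe lQ; exists P => // v /sP.
exact: (path_connect pp).
Qed.

(** * Finding a removable forest *)

Section Reducible.
Context (T : finType) (e : rel T) (S : {set T}).
Hypothesis (symE : symmetric e) (irrE : irreflexive e).
Hypothesis deg2 : forall v, v \in S -> 2 <= deg_in e S v.
Hypothesis cutS : forall v, v \in S -> connected_in e (S :\ v).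
Hypothesis sumdeg : \sum_(v in S) deg_in e S v < 3 * #|S|.

Let D := [set v in S | deg_in e S v == 2].
Let Y := [set v in S | deg_in e S v <= 3].
Let Z := [set v in S | 3 < deg_in e S v].
(** The component of [x] in the graph induced on [Y] has [z] as a neighbour; a component is
    represented by its vertex of degree 2. *)
Let touch x z := [exists y, connect (induced_rel e Y) x y && e y z].

Let memD v : v \in D = (v \in S) && (deg_in e S v == 2).
Proof. by rewrite inE. Qed.
Let memY v : v \in Y = (v \in S) && (deg_in e S v <= 3).
Proof. by rewrite inE. Qed.
Let memZ v : v \in Z = (v \in S) && (3 < deg_in e S v).
Proof. by rewrite inE. Qed.
Let DY x : x \in D -> x \in Y.
Proof. by rewrite memD memY => /andP [-> /eqP ->]. Qed.

(** With degrees averaging below 3, the surplus over 3 at [Z] is less than the deficit, which is 1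
    at each vertex of [D]. *)
Let excess : \sum_(z in Z) (deg_in e S z - 3) < #|D|.
Proof.
(* The indicator of degree 2 compensates for the truncated subtraction. *)
have eqs : \sum_(v in S) (deg_in e S v + (deg_in e S v == 2)) =
           \sum_(v in S) (3 + (deg_in e S v - 3)).
  by apply: eq_bigr => v /deg2; case: eqP => /=; lia.
move: eqs; rewrite !big_split /= sum_nat_const.
have -> : \sum_(v in S) (deg_in e S v == 2 : nat) = #|D|.
  by rewrite -sum1_card big_mkcond [RHS]big_mkcond; apply: eq_bigr => v _;
     rewrite memD; case: (v \in S) => //; case: eqP.
have -> : \sum_(v in S) (deg_in e S v - 3) = \sum_(z in Z) (deg_in e S z - 3).
  rewrite big_mkcond [RHS]big_mkcond; apply: eq_bigr => v _.
  by rewrite memZ; case: (v \in S) => //=; case: ltnP => //; lia.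
lia.
Qed.

Let reducible := exists H : {set T}, [/\ H != set0, H \subset S, forest e H &
  forall v, v \in H -> deg_in e (S :\: H) v <= 1].

Lemma reducible_two_in_component x y :
  x \in D -> y \in D -> x != y -> connect (induced_rel e Y) x y -> reducible.
Proof.
move=> xD yD nxy cxy.
(* With this target the path meets [D] only at its ends: an end has degree 2 and one neighbour on
   the path, an inner vertex has degree at most 3 and two. *)
have yQ : y \in D :\ x by rewrite in_setD1 eq_sym nxy.
have [P ip cP] := induced_path cxy yQ.
have PY v : v \in P -> v \in Y by move/cP; apply: connect_induced_mem (DY xD).
have sPS : P \subset S by apply/subsetP=> v /PY; rewrite memY => /andP [].
exists P; split=> //.
- by apply/set0Pn; exists x; apply: ipath_head ip.
- rewrite -[P]setU0; apply: ipath_forest ip _ _; first exact: forest0.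
    by rewrite -setI_eq0 setI0.
  by move=> v _; rewrite deg_in_eq0 // => u; rewrite inE.
move=> v vP; have := ipath_deg symE ip vP; rewrite in_setD1.
have := deg_inD e v sPS; have := PY v vP; rewrite memY => /andP [_].
case: (eqVneq v x) => [->|nvx] /=.
  by move: xD; rewrite memD => /andP [_ /eqP ->]; lia.
by rewrite memD; case: eqP => //=; rewrite ?andbT ?andbF; lia.
Qed.

Hypothesis D_component : forall x y, x \in D -> y \in D ->
  connect (induced_rel e Y) x y -> x = y.

(** If [Z] were empty, [S] would be almost-cubic with [x] as its vertex of degree 2. If at most [z0]
    were touched, connectedness of [S :\ z0] would put all of it in the component of [x]; then [D]
    is just [x], and [excess] leaves no surplus for [z0]. *)
Lemma component_touch x : ~ almost_cubic_in e S -> x \in D ->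
  1 < #|[set z in Z | touch x z]|.
Proof.
move=> nac xD; have xS : x \in S by move: xD; rewrite memD => /andP [].
have S3 : 2 < #|S|.
  rewrite (cardsD1 x) xS; have := deg2 xS; have : deg_in e S x <= #|S :\ x|; last by lia.
  apply: subset_leq_card; apply/subsetP=> u; rewrite !inE => /andP [-> exu].
  by rewrite andbT; apply: contraTneq exu => ->; rewrite irrE.
have cS := connected_in_setD1 S3 cutS.
rewrite ltnNge; apply/negP => le1.
have [Z0|/set0Pn [z1 z1Z]] := eqVneq Z set0.
  have YS : Y = S.
    apply/setP=> v; rewrite memY; have : v \notin Z by rewrite Z0 inE.
    by rewrite memZ; case: (v \in S) => //=; lia.
  apply: nac; split; first by split.
  exists x; split=> //; first by move: xD; rewrite memD => /andP [_ /eqP].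
  move=> u uS nux; have : u \in Y by rewrite YS.
  rewrite memY uS /=; have := deg2 uS.
  case: (eqVneq (deg_in e S u) 2) => [du|]; last by lia.
  case/eqP: nux; apply/esym; apply: D_component => //; first by rewrite memD uS du.
  by rewrite YS; apply: cS.2.
(* If nothing is touched, any vertex of [Z] serves as [z0]. *)
have [z0 z0Z tz0] : exists2 z0, z0 \in Z & forall z, z \in Z -> touch x z -> z = z0.
  have [A0|/set0Pn [z0]] := eqVneq [set z in Z | touch x z] set0.
    exists z1 => // z zZ tz; have := in_set0 z.
    by rewrite -A0 inE zZ tz.
  rewrite inE => /andP [z0Z tz0]; exists z0 => // z zZ tz.
  by apply: (card_le1_eqP le1); rewrite inE ?zZ ?z0Z.
have z0S : z0 \in S by move: z0Z; rewrite memZ => /andP [].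
have nxz0 : x != z0.
  apply: contraTneq z0Z => <-; move: (DY xD).
  by rewrite memY memZ ltnNge negb_and => /andP [_ ->]; rewrite orbT.
have sub : S :\ z0 \subset [set y | connect (induced_rel e Y) x y].
  apply: (connected_in_closed (x := x) (cutS z0S)); rewrite ?inE ?xS ?nxz0 ?connect0 //.
  move=> a b; rewrite !inE => ca /andP [nbz0 bS] eab.
  have bY : b \in Y.
    rewrite memY bS leqNgt /=; apply: contra nbz0 => db; apply/eqP; apply: tz0.
      by rewrite memZ bS.
    by apply/existsP; exists a; rewrite ca.
  apply: (connect_trans ca); apply: connect1; rewrite /induced_rel /= bY eab !andbT.
  exact: connect_induced_mem (DY xD) ca.
have Dx : D \subset [set x].
  apply/subsetP=> y yD; rewrite inE eq_sym; apply/eqP; apply: D_component => //.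
  have yS : y \in S by move: yD; rewrite memD => /andP [].
  have : y \in S :\ z0.
    rewrite !inE yS andbT; apply: contraTneq z0Z => <-.
    by move: (DY yD); rewrite memY memZ ltnNge negb_and => /andP [_ ->]; rewrite orbT.
  by move/(subsetP sub); rewrite inE.
have := subset_leq_card Dx; rewrite cards1; move: excess.
rewrite (bigD1 z0) //=; move: z0Z; rewrite memZ => /andP [_]; lia.
Qed.

(** Double counting of touching pairs: each [x] in [D] lies in at least 2, while a failing [z] of
    degree [d >= 4] lies in at most [d - 2 <= 2 * (d - 3)]. If every [z] failed, the surplus would
    be at least [#|D|], against [excess]. *)
Lemma vertex_touching_many_components : ~ almost_cubic_in e S ->
  exists2 z, z \in Z & deg_in e S z <= #|[set x in D | touch x z]|.+1.
Proof.
move=> nac; case: (boolP [exists z in Z, deg_in e S z <= #|[set x in D | touch x z]|.+1]).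
  by case/exists_inP=> z; exists z.
move/exists_inPn => no.
have cnt : \sum_(x in D) #|[set z in Z | touch x z]| =
           \sum_(z in Z) #|[set x in D | touch x z]|.
  transitivity (\sum_(x in D) \sum_(z in Z) (touch x z : nat)).
    apply: eq_bigr => x _; rewrite -sum1_card big_mkcond [RHS]big_mkcond.
    by apply: eq_bigr => z _; rewrite inE; case: (z \in Z) => //=; case: touch.
  rewrite exchange_big; apply: eq_bigr => z _.
  rewrite -sum1_card big_mkcond [RHS]big_mkcond.
  by apply: eq_bigr => x _; rewrite inE; case: (x \in D) => //=; case: touch.
have lo : \sum_(x in D) 2 <= \sum_(x in D) #|[set z in Z | touch x z]|.
  by apply: leq_sum => x; apply: component_touch.
have hi : \sum_(z in Z) #|[set x in D | touch x z]| <= \sum_(z in Z) (deg_in e S z - 3).*2.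
  apply: leq_sum => z zZ; have := no z zZ; move: zZ; rewrite memZ => /andP [_].
  by rewrite -ltnNge -muln2; lia.
move: lo hi excess; rewrite cnt sum_nat_const.
have -> : \sum_(z in Z) (deg_in e S z - 3).*2 = (\sum_(z in Z) (deg_in e S z - 3)) * 2.
  by rewrite big_distrl; apply: eq_bigr => z _; rewrite /= muln2.
lia.
Qed.

(** Each path ends at a neighbour of [z], so [z] stands in for the missing successor of its last
    vertex; [z] itself has at least [d - 1] of its [d] neighbours on the paths. *)
Lemma reducible_star z : z \in Z ->
  deg_in e S z <= #|[set x in D | touch x z]|.+1 -> reducible.
Proof.
move=> zZ dz; set Q := [set y | e z y]; set X := [set x in D | touch x z].
have XD x : x \in X -> x \in D by rewrite inE => /andP [].
have pathX x : exists P : {set T}, x \in X ->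
    ipath e Q x P /\ forall v, v \in P -> connect (induced_rel e Y) x v.
  case: (boolP (x \in X)) => [|_]; last by exists set0.
  rewrite inE => /andP [xD /existsP [y /andP [cxy eyz]]].
  have yQ : y \in Q by rewrite inE symE.
  by have [P ip cP] := induced_path cxy yQ; exists P.
have {pathX} [P hP] := fin_all_exists pathX.
have ipP x : x \in X -> ipath e Q x (P x) by case/hP.
have cP x v : x \in X -> v \in P x -> connect (induced_rel e Y) x v.
  by case/hP=> _; apply.
have PY x v : x \in X -> v \in P x -> v \in Y.
  by move=> xX /(cP _ _ xX); apply: connect_induced_mem (DY (XD _ xX)).
have symY : connect_sym (induced_rel e Y).
  by apply: sym_connect_sym => a b; rewrite /induced_rel /= symE andbCA.
(* A common vertex of two paths, or an edge between them, would connect two vertices of [D] inside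
   [Y]. *)
have Papart x x' v u : x \in X -> x' \in X -> v \in P x -> u \in P x' ->
    (v == u) || e v u -> x = x'.
  move=> xX x'X vP uP evu; apply: D_component; rewrite ?XD //.
  apply: connect_trans (cP _ _ xX vP) _; rewrite symY.
  apply: connect_trans (cP _ _ x'X uP) _.
  case/orP: evu => [/eqP -> //|evu]; rewrite symY; apply: connect1.
  by rewrite /induced_rel /= (PY x) // (PY x').
have zY : z \notin Y by move: zZ; rewrite memY memZ => /andP [_]; rewrite ltnNge negb_and => ->; rewrite orbT.
have zP x : x \in X -> z \notin P x by move=> xX; apply: contra zY; apply: PY.
pose H := \bigcup_(x in X) P x :|: [set z].
have zS : z \in S by move: zZ; rewrite memZ => /andP [].
have sHS : H \subset S.
  apply/subsetP=> v; rewrite !inE => /orP [/bigcupP [x xX /(PY _ _ xX)]|/eqP -> //].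
  by rewrite memY => /andP [].
exists H; split=> //.
- by apply/set0Pn; exists z; rewrite !inE eqxx orbT.
- rewrite /H -big_enum /=.
  have : {subset enum X <= X} by move=> x; rewrite mem_enum.
  (* The forest grows from [z] alone, one path at a time. *)
  elim: (enum X) (enum_uniq X) => [|x s IH] /=.
    move=> _ _; rewrite big_nil setUC; apply: forestU1; rewrite ?inE //; first exact: forest0.
    by rewrite deg_in_eq0 // => u; rewrite inE.
  case/andP=> xs us sX; have xX : x \in X by apply: sX; rewrite inE eqxx.
  have sX' y : y \in s -> y \in X by move=> ys; apply: sX; rewrite inE ys orbT.
  rewrite big_cons -setUA; apply: ipath_forest (ipP x xX) _ _; first exact: IH.
    rewrite disjoint_sym disjoint_subset; apply/subsetP=> v vB; rewrite inE.
    apply/negP=> vP; move: vB; rewrite inE bigcup_seq => /orP [/bigcupP [y ys vy]|].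
      by move: xs; rewrite (Papart _ _ _ _ xX (sX' _ ys) vP vy) ?eqxx ?ys.
    by rewrite inE => /eqP vz; move: (zP _ xX); rewrite -vz vP.
  move=> v vP; have only u : u \in \bigcup_(y <- s) P y :|: [set z] -> e v u -> u = z.
    rewrite inE bigcup_seq => /orP [/bigcupP [y ys uy]|] evu; last by move/set1P: evu.
    move: xs; rewrite (Papart _ _ _ _ xX (sX' _ ys) vP uy) ?ys //.
    by rewrite evu orbT.
  case: (boolP (v \in Q)) => vQ; first exact: deg_in_le1 only.
  rewrite deg_in_eq0 // => u uB; apply: contra vQ => evu.
  by rewrite inE symE -(only u uB evu).
move=> v; rewrite {1}/H !inE => /orP [/bigcupP [x xX vP]|/eqP ->].
  have sPH : z |: P x \subset H.
    by apply/subsetP=> u; rewrite !inE => /orP [-> |uP]; rewrite ?orbT //;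
       apply/orP; left; apply/bigcupP; exists x.
  have := deg_in_mono e v sPH; rewrite deg_inU1 ?zP //.
  have := ipath_deg symE (ipP x xX) vP; rewrite inE symE.
  have := deg_inD e v sHS; have := PY x v xX vP; rewrite memY => /andP [_].
  case: (eqVneq v x) => [->|nvx] /=; last by lia.
  by move: (XD _ xX); rewrite memD => /andP [_ /eqP ->]; lia.
(* One neighbour of [z] is chosen on each path; [Papart] makes them distinct. *)
have [q hq] : exists q : T -> T, forall x, x \in X -> q x \in P x /\ e z (q x).
  apply: (fin_all_exists (U := fun=> T) (P := fun x y => x \in X -> y \in P x /\ e z y)) => x.
  case: (boolP (x \in X)) => [xX|_]; last by exists x.
  by have [y yP yQ] := ipath_last (ipP x xX); exists y; rewrite inE in yQ.
have : #|X| <= deg_in e H z.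
  rewrite -(card_in_imset (f := q)).
    apply: subset_leq_card; apply/subsetP=> _ /imsetP [x xX ->].
    have [qP eq] := hq x xX; rewrite !inE eq andbT.
    by apply/orP; left; apply/bigcupP; exists x.
  move=> x x' xX x'X eqq; have [qP _] := hq x xX; have [qP' _] := hq x' x'X.
  by apply: Papart qP qP' _ => //; rewrite eqq eqxx.
by have := deg_inD e z sHS; move: dz; rewrite -/X; lia.
Qed.

End Reducible.

Lemma reducible_forest (T : finType) (e : rel T) (S : {set T}) :
  simple_graph e ->
  (forall v, v \in S -> 2 <= deg_in e S v) ->
  (forall v, v \in S -> connected_in e (S :\ v)) ->
  \sum_(v in S) deg_in e S v < 3 * #|S| ->
  ~ almost_cubic_in e S ->
  exists H : {set T}, [/\ H != set0, H \subset S, forest e H &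
    forall v, v \in H -> deg_in e (S :\: H) v <= 1].
Proof.
move=> [symE irrE] deg2 cutS sumdeg nac.
set D := [set v in S | deg_in e S v == 2].
set Y := [set v in S | deg_in e S v <= 3].
case: (boolP [exists x in D, exists y in D, (x != y) && connect (induced_rel e Y) x y]).
  case/exists_inP=> x xD /exists_inP [y yD /andP [nxy cxy]].
  exact: reducible_two_in_component xD yD nxy cxy.
move=> no; have Dc x y : x \in D -> y \in D -> connect (induced_rel e Y) x y -> x = y.
  move=> xD yD cxy; apply/eqP; apply: contraNT no => nxy.
  by apply/exists_inP; exists x => //; apply/exists_inP; exists y; rewrite ?nxy.
have [z zZ dz] := vertex_touching_many_components irrE deg2 cutS sumdeg Dc nac.
exact: (reducible_star symE deg2 sumdeg Dc zZ dz).
Qed.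

(** * Matchings as permutations, and choices among three colours *)

Import Order.TTheory GRing.Theory Num.Theory.
Local Open Scope ring_scope.

(* The matchings of a cover need not be perfect; completing them to permutations
   is what makes a forbidden colour exist always, and be uniform. *)
Lemma partial_matching_perm (T : finType) (r : rel T) :
  (forall a b b', r a b -> r a b' -> b = b') ->
  (forall a a' b, r a b -> r a' b -> a = a') ->
  exists s : {perm T}, forall a b, r a b -> b = s a.
Proof.
move=> rfun rinj; pose m (s : {perm T}) := #|[set a | r a (s a)]|.
(* Take a permutation agreeing with [r] at the most points. If it missed [b] at [a], composing it
   with [tperm (s a) b] would gain [a] and lose no point. *)
case: (@arg_maxnP _ 1%g xpredT m) => // s _ smax; exists s => a b rab.
apply/eqP; apply: contraT => nb.
have : (m (s * tperm (s a) b)%g <= m s)%N by apply: smax.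
rewrite leqNgt => /negP [].
apply: proper_card; apply/properP; split.
  apply/subsetP=> x; rewrite !inE permM => rx; rewrite tpermD //.
    by apply: contra nb => /eqP /perm_inj xa; move: rx; rewrite -xa => rx; rewrite (rfun _ _ _ rab rx).
  by apply: contra nb => /eqP xb; move: rx; rewrite -xb => rx; rewrite (rinj _ _ _ rab rx) xb eqxx.
exists a; rewrite !inE ?permM ?tpermL //.
by apply: contra nb => ra; rewrite (rfun _ _ _ rab ra).
Qed.

Lemma third_colour (a b : 'I_3) : exists2 c : 'I_3, c != a & c != b.
Proof.
have : (0 < #|~: [set a; b]|)%N.
  by have := cardsC [set a; b]; rewrite card_ord cards2; case: (a != b) => /=; lia.
by case/card_gt0P => c; rewrite !inE negb_or => /andP [ca cb]; exists c.
Qed.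

(** [f] is forbidden in both colourings, [z0] and [z1] in one each. If neither is [f], exchanging
    them works; otherwise a third colour replaces the one equal to [f]. *)
Lemma two_colours_avoiding (f z0 z1 : 'I_3) : z0 != z1 ->
  exists x0 x1 : 'I_3, [/\ x0 != x1, x0 != f, x1 != f, x0 != z0 & x1 != z1].
Proof.
move=> nz; have [z0f|z0f] := eqVneq z0 f.
  have [c cf cz] := third_colour f z1.
  by exists z1, c; rewrite z0f in nz *; split; rewrite // eq_sym.
have [z1f|z1f] := eqVneq z1 f.
  have [c cf cz] := third_colour f z0.
  by exists c, z0; rewrite z1f in nz *; split.
by exists z1, z0; split; rewrite // eq_sym.
Qed.

(** * Packings *)

Section Packing.
(** Every list is identified with ['I_3]; [K u v a b] says that colour [a] at [u] conflicts with
    colour [b] at [v]. *)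
Context (R : realFieldType) (T : finType) (e : rel T) (K : T -> T -> rel 'I_3).
Hypothesis (symE : symmetric e) (irrE : irreflexive e).
Hypothesis symK : forall u v a b, K u v a b = K v u b a.
Hypothesis matchK : forall u v, e u v ->
  exists s : {perm 'I_3}, forall a b, K u v a b -> b = s a.

(* Vertices outside S are unconstrained but still uniformly coloured; this
   supplies a uniform dummy colour wherever one is needed. *)
Definition packs (S : {set T}) : Prop :=
  exists (I : finType) (w : I -> R) (c : I -> T -> 'I_3),
  [/\ forall i, 0 <= w i, \sum_i w i = 1,
      forall v x, \sum_(i | c i v == x) w i = 3%:R^-1 &
      forall i u v, w i != 0 -> u \in S -> v \in S -> e u v ->
        ~~ K u v (c i u) (c i v)].

Lemma packs0 : packs set0.
Proof.
(* One uniform colour is given to all vertices at once. *)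
exists 'I_3, (fun=> 3%:R^-1), (fun i _ => i); split=> [i||v x|i u v _]; last by rewrite inE.
- by rewrite invr_ge0 ler0n.
- by rewrite sumr_const card_ord -[_ *+ 3]mulr_natl divff // pnatr_eq0.
- by rewrite big_pred1_eq.
Qed.

Lemma packs_glue (S1 S2 : {set T}) v : v \in S1 -> v \in S2 ->
  (forall a, a \in S1 -> a \in S2 -> a = v) ->
  (forall a b, a \in S1 -> b \in S2 -> e a b -> a = v \/ b = v) ->
  packs S1 -> packs S2 -> packs (S1 :|: S2).
Proof.
move=> v1 v2 capv sepv [I [w [c [w0 w1 mw cw]]]] [J [w' [c' [w0' w1' mw' cw']]]].
pose col (p : I * J) t := if t \in S1 then c p.1 t else c' p.2 t.
(* Independent draws conditioned on agreement at [v], which has probability 1/3, hence the factor 3.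
   Summing out either index returns the weight of the other. *)
pose W (p : I * J) := if c p.1 v == c' p.2 v then 3%:R * w p.1 * w' p.2 else 0.
have n3 : (3%:R : R) != 0 by rewrite pnatr_eq0.
have sumI i (P : pred J) : P =1 xpredT -> \sum_(j | P j) W (i, j) = w i.
  move=> PT; rewrite (eq_bigl _ _ PT) -big_mkcond /=.
  under eq_bigl => j do rewrite eq_sym.
  by rewrite -mulr_sumr mw' -mulrA mulrCA divff // mulr1.
have sumJ j (P : pred I) : P =1 xpredT -> \sum_(i | P i) W (i, j) = w' j.
  move=> PT; rewrite (eq_bigl _ _ PT) -big_mkcond /=.
  by rewrite -mulr_suml -mulr_sumr mw divff // mul1r.
exists (I * J)%type, W, col; split.
- by move=> p; rewrite /W; case: ifP => // _; rewrite !mulr_ge0 ?ler0n.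
- rewrite -w1 -(pair_bigA _ (fun i j => W (i, j))) /=.
  by apply: eq_bigr => i _; rewrite sumI.
- move=> t x; rewrite /col; case: (boolP (t \in S1)) => tS.
    transitivity (\sum_(i | c i t == x) \sum_j W (i, j)).
      by rewrite pair_big_dep; apply: eq_big => [[i j]|[i j]] //=; rewrite andbT.
    by rewrite -(mw t x); apply: eq_bigr => i _; rewrite sumI.
  transitivity (\sum_i \sum_(j | c' j t == x) W (i, j)).
    by rewrite pair_big_dep; apply: eq_big => [[i j]|[i j]].
  by rewrite exchange_big -(mw' t x); apply: eq_bigr => j _; rewrite sumJ.
move=> [i j] a b; rewrite /W /=; case: (c i v =P c' j v) => [cv|_]; last by rewrite eqxx.
rewrite !mulf_eq0 !negb_or -andbA => /and3P [_ wi wj].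
have col1 t : t \in S1 -> col (i, j) t = c i t by rewrite /col => ->.
have col2 t : t \in S2 -> col (i, j) t = c' j t.
  by rewrite /col; case: ifP => // t1 t2; rewrite (capv _ t1 t2).
have in1 : a \in S1 -> b \in S1 -> e a b -> ~~ K a b (col (i, j) a) (col (i, j) b).
  by move=> a1 b1 eab; rewrite !col1 //; apply: cw.
have in2 : a \in S2 -> b \in S2 -> e a b -> ~~ K a b (col (i, j) a) (col (i, j) b).
  by move=> a1 b1 eab; rewrite !col2 //; apply: cw'.
rewrite !inE => /orP [a1|a2] /orP [b1|b2] eab; [exact: in1| | |exact: in2].
  by case: (sepv a b a1 b2 eab) => E; [apply: in2|apply: in1]; rewrite // E.
have eba : e b a by rewrite symE.
by case: (sepv b a b1 a2 eba) => E; [apply: in2|apply: in1]; rewrite // E.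
Qed.

(** The only coloured neighbour of a new vertex has different colours in the two colourings, so its
    matching permutation forbids different colours [z true] and [z false], as [two_colours_avoiding]
    requires. *)
Lemma forest_two_colourings (H : {set T}) (f : T -> 'I_3) : forest e H ->
  exists c : bool -> T -> 'I_3,
    (forall v, v \in H -> [/\ c true v != c false v, c true v != f v & c false v != f v]) /\
    forall b u v, u \in H -> v \in H -> e u v -> ~~ K u v (c b u) (c b v).
Proof.
elim=> {H} [|H v _ [c [cH cK]] vH dv].
  by exists (fun _ _ => ord0); split=> [v|b u v]; rewrite inE.
have [z [nz Kz]] : exists z : bool -> 'I_3, z true != z false /\
    forall u b x, u \in H -> e v u -> K u v (c b u) x -> x = z b.
  case: (boolP [exists u in H, e v u]) => [/exists_inP [p pH evp]|/exists_inPn no].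
    have epv : e p v by rewrite symE.
    have [s Ks] := matchK epv; exists (fun b => s (c b p)); split.
      by rewrite (inj_eq perm_inj); have [] := cH p pH.
    move=> u b x uH evu; have -> : u = p; last exact: Ks.
    by apply: (card_le1_eqP dv); rewrite inE ?uH ?pH.
  (* Without a neighbour in [H], any two distinct values serve. *)
  exists (fun b => if b then ord0 else ord_max); split=> // u b x /no /negbTE -> //.
have [x1 [x0 [nx x1f x0f x1z x0z]]] := two_colours_avoiding (f v) nz.
pose c' b u := if u == v then (if b then x1 else x0) else c b u.
have c'v b : c' b v = if b then x1 else x0 by rewrite /c' eqxx.
have c'H b u : u \in H -> c' b u = c b u.
  by rewrite /c'; case: eqP => // -> vH'; rewrite vH' in vH.
have ok u b : u \in H -> e v u -> ~~ K u v (c' b u) (c' b v).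
  move=> uH evu; apply/negP; rewrite c'H // => /(Kz u b _ uH evu).
  by rewrite c'v; case: b => /eqP; apply/negP.
exists c'; split=> [u /setU1P [->|uH]|b u t].
- by rewrite !c'v.
- by rewrite !c'H //; apply: cH.
case/setU1P=> [->|uH] /setU1P [->|tH]; first by rewrite irrE.
- by move=> evt; rewrite symK; apply: ok.
- by move=> euv; apply: ok; rewrite // symE.
by rewrite !c'H //; apply: cK.
Qed.

Lemma packs_extend (S H : {set T}) : H \subset S -> forest e H ->
  (forall v, v \in H -> deg_in e (S :\: H) v <= 1)%N ->
  packs (S :\: H) -> packs S.
Proof.
move=> sHS fH dH [I [w [c [w0 w1 mw cw]]]].
(* [g] is the colour forbidden at [v] from outside [H]: a permuted uniform colour, hence uniform. *)
have forbid v : exists g : I -> 'I_3,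
    (forall x, \sum_(i | g i == x) w i = 3%:R^-1) /\
    (v \in H -> forall u i x, u \in S :\: H -> e u v -> K u v (c i u) x -> x = g i).
  case: (boolP (v \in H)) => [vH|_]; last by exists (c^~ v).
  case: (boolP [exists u in S :\: H, e v u]) => [/exists_inP [p pS evp]|/exists_inPn no].
    have epv : e p v by rewrite symE.
    have [s Ks] := matchK epv; exists (fun i => s (c i p)); split.
      move=> x; rewrite -(mw p (s^-1 x)%g); apply: eq_bigl => i.
      by rewrite (can2_eq (permK s) (permKV s)).
    move=> _ u i x uS euv; have -> : u = p; last exact: Ks.
    by apply: (card_le1_eqP (dH v vH)); rewrite inE ?uS ?pS // symE.
  (* Nothing is forbidden here, and the dummy colour of [v] is a uniform choice. *)
  by exists (c^~ v); split=> // _ u i x /no; rewrite symE => /negbTE ->.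
have [g hg] := fin_all_exists forbid.
have [d hd] := fin_all_exists (fun i => forest_two_colourings (fun v => g v i) fH).
pose col (p : I * bool) t := if t \in H then d p.1 p.2 t else c p.1 t.
have half (r : R) : r / 2%:R + r / 2%:R = r by field.
exists (I * bool)%type, (fun p => w p.1 / 2%:R), col; split.
- by move=> p; rewrite divr_ge0 ?ler0n.
- rewrite -(pair_bigA _ (fun i (b : bool) => w i / 2%:R)) /= -[RHS]w1.
  by apply: eq_bigr => i _; rewrite big_bool /= half.
- move=> t x; rewrite /col; case: (boolP (t \in H)) => tH.
    have [gu _] := hg t.
    transitivity (\sum_i \sum_(b | d i b t == x) w i / 2%:R).
      by rewrite pair_big_dep; apply: eq_big => [[i b]|[i b]].
    (* Exactly one of the two colourings uses [x] at [t] when [x] is not forbidden, and neither does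
       otherwise; the total is [(1 - 1/3) / 2 = 1/3]. *)
    transitivity (\sum_(i | g t i != x) w i / 2%:R).
      rewrite [RHS]big_mkcond; apply: eq_bigr => i _.
      rewrite big_mkcond big_bool /=; have [dd _] := hd i; have := dd t tH.
      move: (d i true t) (d i false t) (g t i) => a b f [].
      move: a b f x; do 4! [case; case=> [|[|[|//]]] ?];
        rewrite -!val_eqE //= => _ _ _; by rewrite ?add0r ?addr0.
    rewrite -mulr_suml; have := w1; rewrite (bigID (fun i => g t i == x)) /= gu.
    by move/(canRL (addKr _)) => ->; field.
  transitivity (\sum_(i | c i t == x) \sum_(b : bool) w i / 2%:R).
    by rewrite pair_big_dep; apply: eq_big => [[i b]|[i b]] //=; rewrite andbT.
  by rewrite -(mw t x); apply: eq_bigr => i _; rewrite big_bool /= half.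
move=> [i b] u v; rewrite /= mulf_eq0 negb_or => /andP [wi _] uS vS euv.
have out t : t \in S -> t \notin H -> t \in S :\: H by rewrite inE => -> ->.
have [_ dK] := hd i.
have cross a y : a \in S -> a \notin H -> y \in H -> e a y -> ~~ K a y (c i a) (d i b y).
  move=> aS aH yH eay; apply/negP; have [_ gK] := hg y.
  move/(gK yH _ _ _ (out _ aS aH) eay) => E; have [/(_ y yH) [_ n1 n0] _] := hd i.
  by case: b E => /eqP; apply/negP.
rewrite /col /=; case: (boolP (u \in H)) => uH; case: (boolP (v \in H)) => vH.
- exact: dK.
- by rewrite symK; apply: cross; rewrite // symE.
- exact: cross.
- by apply: cw; rewrite ?out.
Qed.

(** Three cases: a vertex of degree at most 1 is a removable forest by itself; without cut vertices
    [reducible_forest] supplies one; at a cut vertex two smaller packings are glued. *)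
Lemma packs_all (S : {set T}) :
  (forall S : {set T}, S != set0 -> \sum_(v in S) deg_in e S v < 3 * #|S|)%N ->
  (forall S : {set T}, ~ almost_cubic_in e S) -> packs S.
Proof.
move=> sumdeg nac; have [n] := ubnP #|S|; elim: n S => // n IH S Sn.
have [->|S0] := eqVneq S set0; first exact: packs0.
have remove (H : {set T}) : H != set0 -> H \subset S -> forest e H ->
    (forall v, v \in H -> deg_in e (S :\: H) v <= 1)%N -> packs S.
  move=> H0 sHS fH dH; apply: (packs_extend sHS fH dH); apply: IH.
  by rewrite cardsD (setIidPr sHS); move: Sn H0; rewrite -!card_gt0; have := subset_leq_card sHS; lia.
case: (boolP [exists v in S, deg_in e S v <= 1]%N) => [/exists_inP [v vS dv]|/exists_inPn deg2].
  apply: (remove [set v]); rewrite ?sub1set //.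
  - by apply/set0Pn; exists v; rewrite inE.
  - by rewrite -[[set v]]setU0; apply: forestU1 (forest0 e) _ _; rewrite ?inE //
      deg_in_eq0 // => u; rewrite inE.
  - by move=> _ /set1P ->; apply: leq_trans dv; apply: deg_in_mono; apply: subsetDl.
have {}deg2 v : v \in S -> (2 <= deg_in e S v)%N by move/deg2; rewrite -ltnNge.
case: (boolP [forall v in S, forall x in S :\ v, forall y in S :\ v,
    connect (induced_rel e (S :\ v)) x y]) => [/forall_inP cS|].
  have cutS v : v \in S -> connected_in e (S :\ v).
    move=> vS; split; last first.
      by move=> x y xS yS; have /forall_inP /(_ x xS) /forall_inP := cS v vS; apply.
    have /card_gt0P [u] : (0 < deg_in e S v)%N by have := deg2 v vS; lia.
    rewrite inE => /andP [uS evu]; apply/set0Pn; exists u; rewrite !inE uS andbT.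
    by apply: contraTneq evu => ->; rewrite irrE.
  have [H [H0 sHS fH dH]] := reducible_forest (conj symE irrE) deg2 cutS (sumdeg S S0) (nac S).
  exact: remove H0 sHS fH dH.
case/forall_inPn=> v vS /forall_inPn [x xS /forall_inPn [y yS ncxy]].
(* [A] is one component of [S :\ v] and [B] is the rest; both are nonempty, so adding [v] to either
   gives a set smaller than [S]. *)
pose A := [set u in S :\ v | connect (induced_rel e (S :\ v)) x u].
pose B := (S :\ v) :\: A.
have memB u : u \in B = (u \notin A) && (u \in S :\ v) by rewrite inE.
have eqS : S = (v |: A) :|: (v |: B).
  apply/setP=> u; rewrite !inE; case: (eqVneq u v) => [->|nuv] /=; first by rewrite vS.
  by case: (u \in S) => //=; case: (connect (induced_rel e (S :\ v)) x u).
have xA : x \in A by rewrite inE xS connect0.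
have yB : y \in B by rewrite memB yS inE yS (negbTE ncxy).
have vA : v \notin A by rewrite !inE eqxx.
have vB : v \notin B by rewrite !inE eqxx andbF.
have AB : [disjoint A & B].
  by rewrite -setI_eq0; apply/eqP/setP=> u; rewrite in_setI memB in_set0; case: (u \in A).
have cAB : (#|A| + #|B| < #|S|)%N.
  have := cardsD1 v S; rewrite vS.
  have -> : S :\ v = A :|: B.
    apply/setP=> u; rewrite in_setU memB; case uA: (u \in A) => //=.
    by move: uA; rewrite inE => /andP [].
  by rewrite cardsU (disjoint_setI0 AB) cards0; lia.
have A0 : (0 < #|A|)%N by apply/card_gt0P; exists x.
have B0 : (0 < #|B|)%N by apply/card_gt0P; exists y.
rewrite eqS; apply: (@packs_glue _ _ v).
- by rewrite !inE eqxx.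
- by rewrite !inE eqxx.
- move=> a /setU1P [//|aA] /setU1P [//|aB].
  by move: AB => /disjointFr /(_ aA); rewrite aB.
- move=> a b /setU1P [->|aA]; first by left.
  case/setU1P=> [->|bB]; first by right.
  move=> eab; move: bB; rewrite memB => /andP [bA bS]; case/negP: bA.
  rewrite inE bS; move: aA; rewrite inE => /andP [aS ca].
  by apply: (connect_trans ca); apply: connect1; rewrite /induced_rel /= aS bS.
- by apply: IH; rewrite cardsU1 vA; lia.
- by apply: IH; rewrite cardsU1 vB; lia.
Qed.
End Packing.

(** * From maximum average degree and covers to packings *)

Lemma sum_deg_lt_mad (T : finType) (e : rel T) (k : nat) (S : {set T}) :
  symmetric e -> (mad e < k%:R)%R -> S != set0 ->
  (\sum_(v in S) deg_in e S v < k * #|S|)%N.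
Proof.
(* All arcs of the induced subgraph; their number is its degree sum. *)
move=> symE madk S0; pose F := [set p : T * T | [&& p.1 \in S, p.2 \in S & e p.1 p.2]].
have sF : is_subgraph e S F.
  by apply/andP; split; apply/forall_inP => -[u v]; rewrite !inE //= symE andbCA.
have cF : #|F| = (\sum_(v in S) deg_in e S v)%N.
  rewrite -sum1_card (eq_bigr (fun v => \sum_(u | (u \in S) && e v u) 1)%N); last first.
    by move=> v _; rewrite /deg_in -sum1_card; apply: eq_bigl => u; rewrite inE.
  by rewrite pair_big_dep; apply: eq_bigl => -[u v]; rewrite inE.
have : avg_degree S F < k%:R.
  apply: le_lt_trans madk.
  by apply: (le_bigmax_cond _ (fun SF => avg_degree SF.1 SF.2) (j := (S, F))); rewrite S0.
by rewrite /avg_degree ltr_pdivrMr ?ltr0n ?card_gt0 // -natrM ltr_nat cF.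
Qed.

(** The weights are pushed forward along [tr]; fibres are summed because several indices may yield
    the same transversal. *)
Lemma packs_fractional_packing (T W : finType) (e : rel T) (h : rel W)
    (L : T -> {set W}) (X : T -> 'I_3 -> W) :
  corr_cover e h L -> kfold L 3 ->
  (forall v, injective (X v)) -> (forall v x, x \in L v <-> exists a, x = X v a) ->
  packs Rdefinitions.R e (fun u v a b => h (X u a) (X v b)) setT ->
  fractional_packing h L.
Proof.
move=> [[_ irrh] [partL [_ [noE _]]]] L3 Xinj memL [I [w [c [w0 w1 mw cw]]]].
pose tr i := [set X v (c i v) | v : T].
have XL v a : X v a \in L v by apply/memL; exists a.
have Lunique u v x : x \in L u -> x \in L v -> u = v.
  move=> xu xv; apply: (card_le1_eqP (A := [set t | x \in L t])); rewrite ?inE //.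
  by rewrite partL.
have trE i v a : (X v a \in tr i) = (c i v == a).
  apply/imsetP/eqP => [[u _ E]|<-]; last by exists v.
  have uv : u = v by apply: (Lunique _ _ (X v a)); rewrite // E XL.
  by rewrite uv in E; move/Xinj: E.
exists (fun J => \sum_(i | tr i == J) w i); split=> [J|]; first exact: sumr_ge0.
split.
  move=> J nz; have [i /eqP <- wi] : exists2 i, tr i == J & w i != 0.
    apply/exists_inP; apply: contraNT nz => /exists_inPn no.
    by rewrite big1 // => i iJ; apply/eqP; have := no i iJ; rewrite negbK.
  apply/andP; split.
    apply/forallP=> v; apply/cards1P; exists (X v (c i v)); apply/setP=> x.
    rewrite !inE; apply/andP/eqP => [[xt /memL [a xa]]|->]; last by rewrite trE eqxx XL.
    by move: xt; rewrite xa trE => /eqP ->.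
  apply/forall_inP=> _ /imsetP [u _ ->]; apply/forall_inP=> _ /imsetP [v _ ->].
  have [<-|nuv] := eqVneq u v; first by rewrite irrh.
  case: (boolP (e u v)) => euv; first by apply: cw; rewrite ?inE.
  by apply: noE nuv euv _ _.
split.
  rewrite -[RHS]w1 [RHS](partition_big tr xpredT) //=.
move=> v x xL; rewrite L3; have /memL [a xa] := xL.
rewrite -(mw v a) [RHS](partition_big tr (fun J => x \in J)) /=.
  apply: eq_bigr => J xJ; apply: eq_bigl => i; case: eqP => [E|]; last by rewrite andbF.
  by rewrite andbT -trE -xa E xJ.
by move=> i; rewrite xa trE.
Qed.

Theorem mainTheorem8 (T : finType) (e : rel T) :
  simple_graph e ->
  (mad e < 3%:R)%R ->
  (forall S : {set T}, ~ almost_cubic_in e S) ->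
  chi_c_bullet_le e 3.
Proof.
move=> [symE irrE] mad3 nac; exists 3; split=> // W h L cov L3.
(* Numbering each list by ['I_3] turns the edges of [h] into conflicts between colours. *)
pose X v (a : 'I_3) : W := enum_val (cast_ord (esym (L3 v)) a).
have Xinj v : injective (X v) by move=> a b /enum_val_inj /cast_ord_inj.
have memL v x : x \in L v <-> exists a, x = X v a.
  split=> [xL|[a ->]]; last exact: enum_valP.
  exists (cast_ord (L3 v) (enum_rank_in xL x)).
  by rewrite /X cast_ordK enum_rankK_in.
have XL v a : X v a \in L v by apply/memL; exists a.
apply: (packs_fractional_packing cov L3 Xinj memL).
have [[symh _] [_ [_ [_ match_h]]]] := cov.
have fun_h u v a b b' : e u v -> h (X u a) (X v b) -> h (X u a) (X v b') -> b = b'.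
  move=> euv hb hb'; apply: (Xinj v).
  by apply: (card_le1_eqP (match_h _ _ _ euv (XL u a))); rewrite inE XL.
apply: (packs_all _ symE irrE) => [u v a b|u v euv|S|//]; first exact: symh.
  (* The matching condition gives uniqueness in one direction, and symmetry of [h] and [e] gives it
     in the other. *)
  apply: partial_matching_perm => [a b b'|a a' b]; first exact: fun_h.
  by rewrite ![h _ (X v b)]symh; apply: fun_h; rewrite symE.
exact: sum_deg_lt_mad.
Qed.
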